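(* Let $p,q,n$ be positive integers, $\alpha\in\mathbb{N}^p$, $\beta\in\mathbb{N}^q$, and let $N\le n$ be a nonnegative integer. Then there exists a nonnegative integer $M$ with $M\geq\max\{|\alpha|,|\beta|\}$ such that $L_N\subset P_M$, where each $\gamma\in L_N$ is regarded as a real $(p+1)\times(q+1)$ matrix.
   Context: For $\alpha\in\mathbb{N}^p$ write $|\alpha|=\sum_{i=1}^p\alpha_i$, similarly $|\beta|$; $[p]=\{1,\dots,p\}$. $L$ is the set of matrices $\gamma=(\gamma_{ij})$, $i\in\{0,\dots,p\}$, $j\in\{0,\dots,q\}$, with entries in $\mathbb{N}$ such that $\gamma_{00}=0$, $|\gamma|:=\sum_{i,j}\gamma_{ij}\leq n$, $\sum_{j=0}^{q}\gamma_{ij}=\alpha_i$ for $i\in[p]$, and $\sum_{i=0}^{p}\gamma_{ij}=\beta_j$ for $j\in[q]$. $L_N=\{\gamma\in L:|\gamma|=N\}$. For an integer $M\ge\max\{|\alpha|,|\beta|\}$, set $\alpha_0=M-|\alpha|$, $\beta_0=M-|\beta|$, $\overline{\alpha}=(\alpha_0,\alpha_1,\dots,\alpha_p)$, $\overline{\beta}=(\beta_0,\beta_1,\dots,\beta_q)$; the transportation polytope $P_M$ is the set of real matrices $x=(x_{ij})$, $i\in\{0,\dots,p\}$, $j\in\{0,\dots,q\}$, with $x_{ij}\ge0$, $\sum_{j=0}^q x_{ij}=\overline{\alpha}_i$ for all $i\in\{0,\dots,p\}$ and $\sum_{i=0}^p x_{ij}=\overline{\beta}_j$ for all $j\in\{0,\dots,q\}$.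 *)

(* Defs.v *)
From mathcomp Require Import all_boot all_order all_algebra.
From mathcomp Require Import classical_sets reals.

Set Implicit Arguments.
Unset Strict Implicit.
Unset Printing Implicit Defensive.

Import Order.TTheory GRing.Theory Num.Theory.

Local Open Scope classical_set_scope.
Local Open Scope ring_scope.

Definition weight (p : nat) (alpha : 'I_p -> nat) : nat :=
  (\sum_(i < p) alpha i)%N.

Definition mxweight (p q : nat) (gamma : 'M[nat]_(p.+1, q.+1)) : nat :=
  (\sum_(i < p.+1) \sum_(j < q.+1) gamma i j)%N.

(* Indices {0, ..., p} are 'I_p.+1; the index i of [p] is lift ord0 of the
   corresponding element of 'I_p, so that ord0 plays the role of the index 0. *)
Definition L (p q : nat) (alpha : 'I_p -> nat) (beta : 'I_q -> nat)
    (n : nat) : set 'M[nat]_(p.+1, q.+1) :=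
  [set gamma : 'M[nat]_(p.+1, q.+1) |
    [/\ gamma ord0 ord0 = 0%N,
        (mxweight gamma <= n)%N,
        forall i : 'I_p, (\sum_(j < q.+1) gamma (lift ord0 i) j)%N = alpha i
      & forall j : 'I_q, (\sum_(i < p.+1) gamma i (lift ord0 j))%N = beta j]].

Definition Lslice (p q : nat) (alpha : 'I_p -> nat) (beta : 'I_q -> nat)
    (n N : nat) : set 'M[nat]_(p.+1, q.+1) :=
  [set gamma : 'M[nat]_(p.+1, q.+1) | L alpha beta n gamma /\ mxweight gamma = N].

(* The vector (M - |alpha|, alpha_1, ..., alpha_p). It is only meant for
   M >= |alpha|; the subtraction on nat is truncated otherwise. *)
Definition margin (p : nat) (alpha : 'I_p -> nat) (M : nat) (i : 'I_p.+1) : nat :=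
  if unlift ord0 i is Some k then alpha k else (M - weight alpha)%N.

Definition transportation_polytope (R : realType) (p q : nat)
    (alpha : 'I_p -> nat) (beta : 'I_q -> nat) (M : nat) :
    set 'M[R]_(p.+1, q.+1) :=
  [set x : 'M[R]_(p.+1, q.+1) |
    [/\ forall i j, 0 <= x i j,
        forall i, \sum_(j < q.+1) x i j = (margin alpha M i)%:R
      & forall j, \sum_(i < p.+1) x i j = (margin beta M j)%:R]].

Definition real_mx (R : realType) (p q : nat) (gamma : 'M[nat]_(p, q)) :
    'M[R]_(p, q) :=
  map_mx (fun k : nat => k%:R) gamma.

Arguments transportation_polytope R {p q} alpha beta M.
Arguments real_mx R {p q} gamma.

(* Main.v *)
Require Import Defs.
From mathcomp Require Import all_boot all_order all_algebra.
From mathcomp Require Import classical_sets reals.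

(** Row [0] of [gamma] in [L_N] sums to [N - |alpha|] and its column [0] sums
    to [N - |beta|], so [M = N] works as soon as [L_N] is nonempty; if [L_N] is
    empty, any [M >= max(|alpha|, |beta|)] does. The witness
    [max(N, |alpha|, |beta|)] covers both cases. *)

Import GRing.Theory Num.Theory.

Local Open Scope classical_set_scope.

Lemma weight_lift (p : nat) (alpha : 'I_p -> nat) (f : 'I_p.+1 -> nat) :
  (forall i, f (lift ord0 i) = alpha i) ->
  (\sum_(i < p.+1) f i = f ord0 + weight alpha)%N.
Proof.
by move=> fE; rewrite big_ord_recl; congr addn; apply: eq_bigr => i _.
Qed.

(** Removing [weight alpha] from the total of [f] leaves exactly [f ord0], so the truncated
    subtraction in [margin] loses nothing here. *)
Lemma margin_sum (p : nat) (alpha : 'I_p -> nat) (f : 'I_p.+1 -> nat) :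
  (forall i, f (lift ord0 i) = alpha i) ->
  forall i, margin alpha (\sum_(k < p.+1) f k)%N i = f i.
Proof.
move=> fE i; rewrite /margin; case: unliftP => [k ->|->]; first by rewrite fE.
by rewrite (weight_lift _ _ _ fE) addnK.
Qed.

Section Lslice.
Variables (p q n N : nat) (alpha : 'I_p -> nat) (beta : 'I_q -> nat).
Variable gamma : 'M[nat]_(p.+1, q.+1).
Hypothesis gammaL : Lslice alpha beta n N gamma.

(** The total [N] splits by rows as row [0] plus [weight alpha] and, once the sums are exchanged, by
    columns as column [0] plus [weight beta]. *)
Lemma Lslice_weight_le : (maxn (weight alpha) (weight beta) <= N)%N.
Proof.
case: gammaL => -[_ _ rowE colE] <-; rewrite geq_max /mxweight.
rewrite {1}(weight_lift _ _ _ rowE) exchange_big (weight_lift _ _ _ colE).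
by rewrite !leq_addl.
Qed.

(** Membership in [L] prescribes only the rows of positive index; the total [N] then forces the sum
    of row [0]. *)
Lemma Lslice_row (i : 'I_p.+1) :
  (\sum_(j < q.+1) gamma i j)%N = margin alpha N i.
Proof. by case: gammaL => -[_ _ rowE _] <-; rewrite (margin_sum _ _ _ rowE). Qed.

Lemma Lslice_col (j : 'I_q.+1) :
  (\sum_(i < p.+1) gamma i j)%N = margin beta N j.
Proof.
case: gammaL => -[_ _ _ colE] <-.
by rewrite /mxweight exchange_big (margin_sum _ _ _ colE).
Qed.

Lemma Lslice_polytope (R : realType) :
  transportation_polytope R alpha beta N (real_mx R gamma).
Proof.
split=> [i j|i|j]; first by rewrite mxE ler0n.
  by rewrite -Lslice_row natr_sum; apply: eq_bigr => j _; rewrite mxE.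
by rewrite -Lslice_col natr_sum; apply: eq_bigr => i _; rewrite mxE.
Qed.

End Lslice.

Theorem theorem3p6 (R : realType) (p q n : nat)
    (p_gt0 : (0 < p)%N) (q_gt0 : (0 < q)%N) (n_gt0 : (0 < n)%N)
    (alpha : 'I_p -> nat) (beta : 'I_q -> nat) (N : nat) (le_Nn : (N <= n)%N) :
  exists M : nat,
    (maxn (weight alpha) (weight beta) <= M)%N /\
    real_mx R @` Lslice alpha beta n N
      `<=` transportation_polytope R alpha beta M.
Proof.
exists (maxn N (maxn (weight alpha) (weight beta))); split.
  exact: leq_maxr.
move=> _ [gamma gammaL <-].
(* A member of the slice makes [N] dominate both weights, so the witness collapses to [N]. *)
rewrite (maxn_idPl (Lslice_weight_le _ _ _ _ _ _ _ gammaL)).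
exact: Lslice_polytope gammaL R.
Qed.
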